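(* For $x$ of modulus $1$ with $x\ne\pm\mathbf{i}$ let $M_6(x)$ be the $6\times 6$ matrix defined in the context. Then: (1) $M_6(1)\cong F_6$; (2) $\lim\limits_{t\to \frac{3\pi}{2}}M_6\left(e^{\mathbf{i}t}\right)\cong D_6$; (3) $M_6\!\left(e^{\mathbf{i}\arccos\left(\frac{1-\sqrt{13}}{3}\right)}\right)=M_6$, where $M_6$ is the fixed matrix defined in the context.
   Context: $\mathbf{i}$ denotes the imaginary unit. A complex Hadamard matrix of order $n$ is an $n\times n$ complex matrix $H$ with all entries of modulus $1$ and $HH^*=nI$. Two such matrices are equivalent, $H_1\cong H_2$, if $H_1=D_1P_1H_2P_2D_2$ with unitary diagonal matrices $D_1,D_2$ and permutation matrices $P_1,P_2$. $F_6=[e^{2\pi\mathbf{i}jk/6}]_{j,k=0}^{5}$ is the Fourier matrix, and $D_6$ is Diţă's matrix $$D_6=\begin{bmatrix}1&1&1&1&1&1\\1&-1&\mathbf{i}&-\mathbf{i}&-\mathbf{i}&\mathbf{i}\\1&\mathbf{i}&-1&\mathbf{i}&-\mathbf{i}&-\mathbf{i}\\1&-\mathbf{i}&\mathbf{i}&-1&\mathbf{i}&-\mathbf{i}\\1&-\mathbf{i}&-\mathbf{i}&\mathbf{i}&-1&\mathbf{i}\\1&\mathbf{i}&-\mathbf{i}&-\mathbf{i}&\mathbf{i}&-1\end{bmatrix}.$$ For $|x|=1$, $x\neq\pm\mathbf{i}$, the family $M_6(x)$ is $$M_6(x)=\begin{bmatrix}1&1&1&1&1&1\\1&-1&x&x&-x&-x\\1&x&d&a&b&c\\1&x&a&d&c&b\\1&-x&b&c&p&q\\1&-x&c&b&q&p\end{bmatrix},$$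 with $$a=\frac{x^2-2x-1}{4}-\mathbf{i}\,\frac{(x^2-2x-1)\sqrt{16-|x^2-2x-1|^2}}{4|x^2-2x-1|},\qquad d=\frac{x^2-2x-1}{4}+\mathbf{i}\,\frac{(x^2-2x-1)\sqrt{16-|x^2-2x-1|^2}}{4|x^2-2x-1|},$$ $$b=-\frac{1+x^2}{4}-\mathbf{i}\,\frac{(1+x^2)\sqrt{16-|1+x^2|^2}}{4|1+x^2|},\qquad c=-\frac{1+x^2}{4}+\mathbf{i}\,\frac{(1+x^2)\sqrt{16-|1+x^2|^2}}{4|1+x^2|},$$ $$p=\frac{x^2+2x-1}{4}+\mathbf{i}\,\frac{(x^2+2x-1)\sqrt{16-|x^2+2x-1|^2}}{4|x^2+2x-1|},\qquad q=\frac{x^2+2x-1}{4}-\mathbf{i}\,\frac{(x^2+2x-1)\sqrt{16-|x^2+2x-1|^2}}{4|x^2+2x-1|}.$$ The fixed matrix $M_6$ is $$M_6=\begin{bmatrix}1&1&1&1&1&1\\1&-1&x_1&x_1&-x_1&-x_1\\1&x_1&1&a_1&b_1&c_1\\1&x_1&a_1&1&c_1&b_1\\1&-x_1&b_1&c_1&p_1&q_1\\1&-x_1&c_1&b_1&q_1&p_1\end{bmatrix},$$ with $$x_1=\frac{1-\sqrt{13}}{3}+\mathbf{i}\frac{\sqrt{-5+2\sqrt{13}}}{3},\qquad a_1=-\frac{7-\sqrt{13}}{9}-\mathbf{i}\frac{\sqrt{19+14\sqrt{13}}}{9},$$ $$b_1=\frac{-14+2\sqrt{13}-\sqrt{-58+34\sqrt{13}}}{18}-\mathbf{i}\frac{\sqrt{134+22\sqrt{13}-8\sqrt{-2446+730\sqrt{13}}}}{18},$$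 $$c_1=\frac{-14+2\sqrt{13}+\sqrt{-58+34\sqrt{13}}}{18}+\mathbf{i}\frac{\sqrt{134+22\sqrt{13}+8\sqrt{-2446+730\sqrt{13}}}}{18},$$ $$p_1=3-\sqrt{13}-\mathbf{i}\sqrt{-21+6\sqrt{13}},\qquad q_1=\frac{-19+4\sqrt{13}}{9}+\mathbf{i}\frac{2\sqrt{-122+38\sqrt{13}}}{9}.$$
   Formalization: In (2) the two-sided limit at 3π/2 does not exist, since (b,c) tends to (1,-1) from the left and (-1,1) from the right; the formal theorem instead states that both one-sided limits exist and each is equivalent to D_6. *)

(* Defs.v *)
From HB Require Import structures.
From mathcomp Require Export all_boot all_order all_algebra.
From mathcomp Require Export all_classical all_reals all_analysis.
From mathcomp Require Export complex.
Export Order.TTheory GRing.Theory Num.Theory numFieldNormedType.Exports.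

Set Implicit Arguments.
Unset Strict Implicit.
Unset Printing Implicit Defensive.

Local Open Scope sesquilinear_scope.
Local Open Scope ring_scope.
Local Open Scope complex_scope.

Definition complex_hadamard (R : realType) (n : nat) (H : 'M[R[i]]_n) : Prop :=
  (forall i j, `|H i j| = 1) /\ H *m H ^t* = (n%:R)%:M.

Definition hadamard_equiv (R : realType) (n : nat) (H1 H2 : 'M[R[i]]_n) : Prop :=
  [/\ complex_hadamard H1, complex_hadamard H2 &
    exists D1 P1 P2 D2 : 'M[R[i]]_n,
      [/\ is_diag_mx D1 && (D1 \is unitarymx),
          is_diag_mx D2 && (D2 \is unitarymx),
          is_perm_mx P1,
          is_perm_mx P2 &
          H1 = D1 *m P1 *m H2 *m P2 *m D2]].

Definition expi (R : realType) (t : R) : R[i] := cos t +i* sin t.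

Definition mx6_of_rows (R : realType) (s : seq (seq R[i])) : 'M[R[i]]_6 :=
  \matrix_(i < 6, j < 6) nth 0 (nth [::] s i) j.

Definition F6 (R : realType) : 'M[R[i]]_6 :=
  \matrix_(j < 6, k < 6) expi (2 * pi * j%:R * k%:R / 6).

Definition D6 (R : realType) : 'M[R[i]]_6 :=
  let I : R[i] := 'i in
  mx6_of_rows
    [:: [:: 1;  1;  1;  1;  1;  1];
        [:: 1; -1;  I; -I; -I;  I];
        [:: 1;  I; -1;  I; -I; -I];
        [:: 1; -I;  I; -1;  I; -I];
        [:: 1; -I; -I;  I; -1;  I];
        [:: 1;  I; -I; -I;  I; -1]].

Definition M6_shape (R : realType) (x d a b c p q : R[i]) : 'M[R[i]]_6 :=
  mx6_of_rows
    [:: [:: 1;  1;  1;  1;  1;  1];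
        [:: 1; -1;  x;  x; -x; -x];
        [:: 1;  x;  d;  a;  b;  c];
        [:: 1;  x;  a;  d;  c;  b];
        [:: 1; -x;  b;  c;  p;  q];
        [:: 1; -x;  c;  b;  q;  p]].

(* The modulus as an element of R; the generic `|z| lives in R[i]. *)
Notation normc := ComplexField.Normc.normc.

Definition M6_rad (R : realType) (u : R[i]) : R[i] :=
  'i * (u * (Num.sqrt (16 - normc u ^+ 2))%:C / (4 * (normc u)%:C)).

(* M_6(x) is meant for |x| = 1 and x <> i, -i: there the three arguments of
   M6_rad are nonzero and of modulus at most 4. Elsewhere the value is junk.
   Since 1 + e^(2it) = 2 cos(t) e^(it), as t -> 3 pi/2 the entries (b, c) tend
   to (1, -1) from the left and to (-1, 1) from the right, so M_6(e^(it)) has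
   two distinct one-sided limits there and no two-sided limit. *)
Definition M6_family (R : realType) (x : R[i]) : 'M[R[i]]_6 :=
  let u := x ^+ 2 - 2 * x - 1 in
  let v := 1 + x ^+ 2 in
  let w := x ^+ 2 + 2 * x - 1 in
  let a := u / 4 - M6_rad u in
  let d := u / 4 + M6_rad u in
  let b := - (v / 4) - M6_rad v in
  let c := - (v / 4) + M6_rad v in
  let p := w / 4 + M6_rad w in
  let q := w / 4 - M6_rad w in
  M6_shape x d a b c p q.

Definition M6_fixed (R : realType) : 'M[R[i]]_6 :=
  let s : R := Num.sqrt 13 in
  let x1 := ((1 - s) / 3) +i* (Num.sqrt (- 5 + 2 * s) / 3) in
  let a1 := (- ((7 - s) / 9)) -i* (Num.sqrt (19 + 14 * s) / 9) in
  let b1 := ((- 14 + 2 * s - Num.sqrt (- 58 + 34 * s)) / 18)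
     -i* (Num.sqrt (134 + 22 * s - 8 * Num.sqrt (- 2446 + 730 * s)) / 18) in
  let c1 := ((- 14 + 2 * s + Num.sqrt (- 58 + 34 * s)) / 18)
     +i* (Num.sqrt (134 + 22 * s + 8 * Num.sqrt (- 2446 + 730 * s)) / 18) in
  let p1 := (3 - s) -i* Num.sqrt (- 21 + 6 * s) in
  let q1 := ((- 19 + 4 * s) / 9) +i* (2 * Num.sqrt (- 122 + 38 * s) / 9) in
  M6_shape x1 1 a1 b1 c1 p1 q1.

(* Main.v *)
Require Import Defs.
From mathcomp Require Import perm ring lra.

Set Implicit Arguments.
Unset Strict Implicit.
Unset Printing Implicit Defensive.

(* Write x = e^(it), C = cos t and S = sin t.  The three arguments of the radicals are
   x^2 - 2x - 1 = 2x(-1 + iS), 1 + x^2 = 2Cx and x^2 + 2x - 1 = 2x(1 + iS), so that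
   with r = sqrt((3 - S^2)/(1 + S^2)) and k = sg(C) sqrt(4 - C^2) every entry of
   M_6(x) is half a product of x and linear forms in S, C, r, k.  Only k is
   discontinuous at 3pi/2, through the sign of C.
   At t = 0, and in the two one-sided limits at 3pi/2, all entries are powers of
   e^(i pi/3), respectively of i; equivalence with F_6 and D_6 is then a congruence
   between tables of exponents.  For C = (1 - sqrt 13)/3 one finds
   r = 3S = sqrt(2 sqrt 13 - 5), and the nested radicals of the fixed matrix are
   polynomials in sqrt 13, r and sqrt(22 + 2 sqrt 13). *)

Local Open Scope classical_set_scope.
Local Open Scope sesquilinear_scope.
Local Open Scope ring_scope.
Local Open Scope complex_scope.

(** * Monomial equivalence and tables of exponents *)

Lemma diag_mx_unitary (R : realType) (n : nat) (d : 'I_n -> R[i]) :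
  (forall j, `|d j| = 1) ->
  is_diag_mx (diag_mx (\row_j d j)) && (diag_mx (\row_j d j) \is unitarymx).
Proof.
move=> d1; rewrite diag_mx_is_diag /=; apply/unitarymxP/matrixP => i j.
rewrite mul_diag_mx !mxE; have [->|_] := eqVneq i j; last first.
  by rewrite mulr0n rmorph0 mulr0.
by rewrite mulr1n -normCK d1 expr1n.
Qed.

Lemma perm_mx_unitary (R : realType) (n : nat) (s : 'S_n) :
  (perm_mx s : 'M[R[i]]_n) \is unitarymx.
Proof.
apply/unitarymxP; suff -> : (perm_mx s : 'M[R[i]]_n) ^t* = perm_mx s^-1.
  by rewrite -perm_mxM mulgV perm_mx1.
by rewrite -tr_perm_mx; apply/matrixP => i j; rewrite !mxE rmorph_nat.
Qed.

(** The products U = D1 P1 and V = P2 D2 are unitary, hence [H1] = U [H2] V satisfies the same Gram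
    identity as [H2]. Equivalences thus reduce to entrywise identities, without a separate proof
    that [H1] is Hadamard. *)
Lemma monomial_hadamard_equiv (R : realType) (n : nat) (H1 H2 : 'M[R[i]]_n)
    (r c : 'I_n -> R[i]) (s t : 'S_n) :
  complex_hadamard H2 -> (forall i, `|r i| = 1) -> (forall j, `|c j| = 1) ->
  (forall i j, H1 i j = r i * H2 (s i) (t j) * c j) ->
  hadamard_equiv H1 H2.
Proof.
move=> H2had r1 c1 H1E; have [H2_1 H2H2] := H2had.
set D1 := diag_mx (\row_i r i); set D2 := diag_mx (\row_j c j).
(* Right multiplication by [perm_mx t^-1] is what sends column [t j] to position [j], hence the
   inverse. *)
have H1D : H1 = D1 *m perm_mx s *m H2 *m perm_mx t^-1 *m D2.
  rewrite /D2 mul_mx_diag -col_permE -mulmxA -row_permE /D1 mul_diag_mx.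
  by apply/matrixP => i j; rewrite H1E !mxE.
have D1u := diag_mx_unitary r1; have D2u := diag_mx_unitary c1.
split=> //; last first.
  exists D1, (perm_mx s), (perm_mx t^-1), D2.
  by split; [exact: D1u | exact: D2u | exact: perm_mx_is_perm
            | exact: perm_mx_is_perm | exact: H1D].
split=> [i j|]; first by rewrite H1E !normrM r1 c1 H2_1 !mulr1.
have U : D1 *m perm_mx s \is unitarymx.
  by apply: mul_unitarymx (perm_mx_unitary _ _); have /andP[] := D1u.
have V : perm_mx t^-1 *m D2 \is unitarymx.
  by apply: mul_unitarymx (perm_mx_unitary _ _) _; have /andP[] := D2u.
rewrite H1D -(mulmxA _ (perm_mx t^-1)).
move: (D1 *m _) (_ *m D2) U V => U V /unitarymxP UU /unitarymxP VV.
rewrite !(trmx_mul, map_mxM) /= -!mulmxA (mulmxA V) VV mul1mx (mulmxA H2) H2H2.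
by rewrite mul_scalar_mx -scalemxAr UU scalemx1.
Qed.

(** Lets explicit lists stand for permutations, so that comparing two tables is a matter of
    evaluation. *)
Lemma perm_of_seq (n : nat) (s : seq nat) :
  perm_eq s (iota 0 n) -> exists p : 'S_n, forall i, p i = nth 0 s i :> nat.
Proof.
move=> ps.
have sz : size s = n by rewrite (perm_size ps) size_iota.
have lts (i : 'I_n) : (nth 0 s i < n)%N.
  have : nth 0%N s i \in iota 0 n.
    by rewrite -(perm_mem ps) mem_nth // sz.
  by rewrite mem_iota.
have inj : injective (fun i : 'I_n => Ordinal (lts i)).
  move=> i j /(congr1 val) /= /eqP.
  rewrite nth_uniq ?sz ?ltn_ord //; last by rewrite (perm_uniq ps) iota_uniq.
  by move=> /eqP /val_inj.
by exists (perm inj) => i; rewrite permE.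
Qed.

Definition exponent (E : seq (seq nat)) (i j : nat) : nat :=
  nth 0%N (nth [::] E i) j.

Definition root_mx (R : realType) (z : R[i]) (E : seq (seq nat)) : 'M[R[i]]_6 :=
  \matrix_(i, j) z ^+ exponent E i j.

Lemma root_mx_hadamard (R : realType) (z : R[i]) (k : nat)
    (E : seq (seq nat)) :
  `|z| = 1 -> z ^+ k.+1 = 1 ->
  (forall i j : 'I_6, i != j ->
     \sum_(l < 6) z ^+ (exponent E i l + k * exponent E j l) = 0) ->
  complex_hadamard (root_mx z E).
Proof.
move=> z1 zk Eort; split=> [i j|]; first by rewrite mxE normrX z1 expr1n.
have z0 : z != 0 by rewrite -normr_eq0 z1 oner_neq0.
(* Conjugation inverts a number of modulus 1, and the inverse of z is z^k. *)
have zJ : Num.conj z = z ^+ k.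
  by apply: (mulfI z0); rewrite -normCK z1 expr1n -exprS zk.
apply/matrixP => i j; rewrite !mxE.
under eq_bigr do rewrite !mxE rmorphXn /= zJ -exprM -exprD.
have [<-|/Eort -> //] := eqVneq i j.
under eq_bigr do rewrite -mulSn exprM zk expr1n.
by rewrite sumr_const card_ord.
Qed.

(** With phases that are powers of [z] too, multiplying entries adds exponents modulo [k], and
    equivalence becomes a finite check on natural numbers. Lists [r] and [c] that are too short are
    read as 0 beyond their end, that is, as phase 1. *)
Lemma root_mx_equiv (R : realType) (z : R[i]) (k : nat)
    (E1 E2 : seq (seq nat)) (s t r c : seq nat) :
  `|z| = 1 -> z ^+ k = 1 -> perm_eq s (iota 0 6) -> perm_eq t (iota 0 6) ->
  (forall i j : 'I_6, exponent E1 i j =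
     nth 0 r i + exponent E2 (nth 0 s i) (nth 0 t j) + nth 0 c j %[mod k])%N ->
  complex_hadamard (root_mx z E2) ->
  hadamard_equiv (root_mx z E1) (root_mx z E2).
Proof.
move=> z1 zk /perm_of_seq[p pE] /perm_of_seq[q qE] E12 H2.
have z1X m : `|z ^+ m| = 1 by rewrite normrX z1 expr1n.
apply: (@monomial_hadamard_equiv _ _ _ _ (fun i => z ^+ nth 0%N r i)
  (fun j => z ^+ nth 0%N c j) p q) => // i j.
by rewrite !mxE pE qE -!exprD -(expr_mod _ zk) E12 expr_mod.
Qed.

(** The multiplication table of Z/6. *)
Definition F6_exponents : seq (seq nat) :=
  [:: [:: 0; 0; 0; 0; 0; 0]; [:: 0; 1; 2; 3; 4; 5]; [:: 0; 2; 4; 0; 2; 4];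
      [:: 0; 3; 0; 3; 0; 3]; [:: 0; 4; 2; 0; 4; 2]; [:: 0; 5; 4; 3; 2; 1]]%N.

Definition D6_exponents : seq (seq nat) :=
  [:: [:: 0; 0; 0; 0; 0; 0]; [:: 0; 2; 1; 3; 3; 1]; [:: 0; 1; 2; 1; 3; 3];
      [:: 0; 3; 1; 2; 1; 3]; [:: 0; 3; 3; 1; 2; 1]; [:: 0; 1; 3; 3; 1; 2]]%N.

(** The relation z^2 = z - 1 characterises primitive sixth roots of unity; it yields z^6 = 1 and
    makes each product of distinct rows vanish. *)
Lemma F6_exponents_hadamard (R : realType) (z : R[i]) :
  `|z| = 1 -> z ^+ 2 = z - 1 -> complex_hadamard (root_mx z F6_exponents).
Proof.
move=> z1 z2; apply: (@root_mx_hadamard _ _ 5) => //; first by ring: z2.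
move=> i j; rewrite -val_eqE /=.
case: i => [[|[|[|[|[|[|i]]]]]] //= _]; case: j => [[|[|[|[|[|[|j]]]]]] //= _] //.
all: move=> _; rewrite !big_ord_recr big_ord0 /=; ring: z2.
Qed.

Lemma D6_exponents_hadamard (R : realType) (z : R[i]) :
  `|z| = 1 -> z ^+ 2 = -1 -> complex_hadamard (root_mx z D6_exponents).
Proof.
move=> z1 z2; apply: (@root_mx_hadamard _ _ 3) => //; first by ring: z2.
move=> i j; rewrite -val_eqE /=.
case: i => [[|[|[|[|[|[|i]]]]]] //= _]; case: j => [[|[|[|[|[|[|j]]]]]] //= _] //.
all: move=> _; rewrite !big_ord_recr big_ord0 /=; ring: z2.
Qed.

(** * Convergence, and the family on the unit circle *)

(** A neighbourhood of a matrix contains a box of neighbourhoods of its entries, and a filter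
    absorbs the finitely many intersections. *)
Lemma cvg_mx_entries (T : topologicalType) (m n : nat) (I : Type)
    (F : set_system I) (FF : Filter F) (f : I -> 'M[T]_(m, n)) (L : 'M[T]_(m, n)) :
  (forall i j, (f t i j : T) @[t --> F] --> (L i j : T)) -> f @ F --> L.
Proof.
move=> fL A [P LP PA]; apply: filterS PA _.
have fP : \forall t \near F, forall i j, P i j (f t i j).
  by apply: filter_forall => i; apply: filter_forall => j; exact: fL (LP i j).
exact: fP.
Qed.

Lemma cvg_real_complex (R : realType) (I : Type) (F : set_system I)
    (FF : Filter F) (f : I -> R) (a : R) :
  f @ F --> a -> ((f t)%:C : (R[i])^o) @[t --> F] --> (a%:C : (R[i])^o).
Proof.
move=> fa; apply/cvgrPdist_lt => e e0.
(* A positive element of [R[i]] is real, so the complex radius comes from a real one. *)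
have [d d0 ->] : exists2 d, 0 < d & e = d%:C.
  exists (complex.Re e); first by move: e0; rewrite ltcE => /andP[].
  by rewrite RRe_real // gtr0_real.
move/cvgrPdist_lt : fa => /(_ d d0); apply: filterS => t.
rewrite -rmorphB normc_def /= expr0n addr0 sqrtr_sqr.
by rewrite ltcR.
Qed.

Lemma cvg_complex (R : realType) (I : Type) (F : set_system I)
    (FF : Filter F) (f g : I -> R) (a b : R) :
  f @ F --> a -> g @ F --> b ->
  ((f t +i* g t) : (R[i])^o) @[t --> F] --> (a +i* b : (R[i])^o).
Proof.
move=> fa gb; rewrite [a +i* b]complexE /=.
under eq_fun do rewrite [_ +i* _]complexE /=.
apply: cvgD; first exact: cvg_real_complex.
by apply: cvgM; [exact: cvg_cst | exact: cvg_real_complex].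
Qed.

(** Each entry is 1, one of the seven parameters, or the opposite of one of these. Keeping [P]
    abstract does the case analysis once, free of topology. *)
Lemma M6_shape_entries (R : realType) (I : Type)
    (P : (I -> R[i]) -> R[i] -> Prop) (x d a b c p q : I -> R[i])
    (x' d' a' b' c' p' q' : R[i]) :
  P (fun=> 1) 1 -> (forall f l, P f l -> P (fun t => - f t) (- l)) ->
  P x x' -> P d d' -> P a a' -> P b b' -> P c c' -> P p p' -> P q q' ->
  forall i j,
    P (fun t => M6_shape (x t) (d t) (a t) (b t) (c t) (p t) (q t) i j)
      (M6_shape x' d' a' b' c' p' q' i j).
Proof.
move=> P1 PN Px Pd Pa Pb Pc Pp Pq i j.
under eq_fun do rewrite mxE.
rewrite mxE.
case: i => [[|[|[|[|[|[|i]]]]]] i6]; last by [].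
all: case: j => [[|[|[|[|[|[|j]]]]]] j6]; last by [].
all: by rewrite /=; auto.
Qed.

Lemma cvg_M6_shape (R : realType) (I : Type) (F : set_system I)
    (FF : Filter F) (x d a b c p q : I -> R[i]) (x' d' a' b' c' p' q' : R[i]) :
  let cvgC (f : I -> R[i]) (l : R[i]) :=
    (f t : (R[i])^o) @[t --> F] --> (l : (R[i])^o) in
  cvgC x x' -> cvgC d d' -> cvgC a a' -> cvgC b b' -> cvgC c c' ->
  cvgC p p' -> cvgC q q' ->
  (M6_shape (x t) (d t) (a t) (b t) (c t) (p t) (q t) : 'M[(R[i])^o]_6)
    @[t --> F] --> (M6_shape x' d' a' b' c' p' q' : 'M[(R[i])^o]_6).
Proof.
move=> cvgC xx dd aa bb cc pp qq.
have c1 : cvgC (fun=> 1) 1 by exact: cvg_cst.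
have cN f l : cvgC f l -> cvgC (fun t => - f t) (- l) by exact: cvgN.
have entries := @M6_shape_entries R I cvgC _ _ _ _ _ _ _ _ _ _ _ _ _ _
  c1 cN xx dd aa bb cc pp qq.
by apply: cvg_mx_entries => i j; exact: (entries i j).
Qed.

Lemma normc_sqrE (R : realType) (a b : R) :
  ComplexField.Normc.normc (a +i* b) ^+ 2 = a ^+ 2 + b ^+ 2.
Proof. by rewrite sqr_sqrtr // addr_ge0 ?sqr_ge0. Qed.

Lemma normc_expi (R : realType) (t : R) :
  ComplexField.Normc.normc (expi t) = 1.
Proof. by rewrite /= cos2Dsin2 sqrtr1. Qed.

(** Moving the division by the modulus under the root leaves only the squared modulus, which is
    polynomial in the real and imaginary parts. *)
Lemma M6_rad_sqrt (R : realType) (u : R[i]) : u != 0 ->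
  M6_rad u =
  'i%C * u * (Num.sqrt (16 / ComplexField.Normc.normc u ^+ 2 - 1) / 4)%:C.
Proof.
move=> u0; rewrite /M6_rad -?complexiE; set n := ComplexField.Normc.normc u.
have n0 : n != 0 by apply: contraNneq u0 => /ComplexField.Normc.eq0_normc ->.
have nge0 : 0 <= n by rewrite /n; case: (u) => ? ? /=; exact: sqrtr_ge0.
have -> : 16 / n ^+ 2 - 1 = (n^-1) ^+ 2 * (16 - n ^+ 2) by field.
rewrite sqrtrM ?sqr_ge0 // sqrtr_sqr ger0_norm ?invr_ge0 //.
have nC0 : n%:C != 0 by rewrite (inj_eq (@complexI R)).
rewrite !rmorphM !fmorphV rmorph_nat; field.
by rewrite nC0.
Qed.

Lemma M6_rad_expi (R : realType) (t a b : R) : a ^+ 2 + b ^+ 2 != 0 ->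
  M6_rad (expi t * (a +i* b)) =
  'i%C * (expi t * (a +i* b)) *
    (Num.sqrt (16 / (a ^+ 2 + b ^+ 2) - 1) / 4)%:C.
Proof.
move=> ab0.
have nE : ComplexField.Normc.normc (expi t * (a +i* b)) ^+ 2 = a ^+ 2 + b ^+ 2.
  by rewrite ComplexField.Normc.normcM normc_expi mul1r normc_sqrE.
rewrite M6_rad_sqrt ?nE //; apply: contraNneq ab0 => u0.
by rewrite -nE u0 ComplexField.Normc.normc0 expr0n.
Qed.

Lemma M6_family_expi (R : realType) (t : R) : cos t != 0 ->
  let x := expi t in
  let r := Num.sqrt ((3 - sin t ^+ 2) / (1 + sin t ^+ 2)) in
  let k := Num.sg (cos t) * Num.sqrt (4 - cos t ^+ 2) in
  M6_family x = M6_shape x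
    (x * (-1 +i* sin t) * (1 +i* r) / 2)
    (x * (-1 +i* sin t) * (1 -i* r) / 2)
    (- (x * (cos t +i* k) / 2))
    (- (x * (cos t -i* k) / 2))
    (x * (1 +i* sin t) * (1 +i* r) / 2)
    (x * (1 +i* sin t) * (1 -i* r) / 2).
Proof.
move=> C0 x r k; rewrite /M6_family.
have i2 : 'i%C ^+ 2 = -1 :> R[i] by exact: sqr_i.
have C2 : (cos t)%:C ^+ 2 = 1 - (sin t)%:C ^+ 2 :> R[i].
  have <- : (1 - sin t ^+ 2)%:C = 1 - (sin t)%:C ^+ 2 :> R[i].
    by rewrite rmorphB rmorphXn rmorph1.
  by rewrite -(cos2Dsin2 t) addrK rmorphXn.
have xE : x = (cos t)%:C + 'i%C * (sin t)%:C by rewrite [x]complexE.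
have S2 : 0 < 1 + sin t ^+ 2 by rewrite ltr_pwDl // sqr_ge0.
have ab4 : 2 ^+ 2 + (2 * sin t) ^+ 2 = 4 * (1 + sin t ^+ 2) by ring.
have ab0 : 2 ^+ 2 + (2 * sin t) ^+ 2 != 0 by rewrite ab4 mulf_neq0 // gt_eqF.
have uE : x ^+ 2 - 2 * x - 1 = x * (- 2 +i* (2 * sin t)).
  rewrite [_ +i* _]complexE /= rmorphN rmorphM rmorph_nat xE; ring: i2 C2.
have wE : x ^+ 2 + 2 * x - 1 = x * (2 +i* (2 * sin t)).
  rewrite [_ +i* _]complexE /= rmorphM rmorph_nat xE; ring: i2 C2.
have vE : 1 + x ^+ 2 = x * (2 * cos t +i* 0).
  rewrite [_ +i* _]complexE /= rmorphM rmorph_nat rmorph0 xE; ring: i2 C2.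
have sqrt_uw : Num.sqrt (16 / (2 ^+ 2 + (2 * sin t) ^+ 2) - 1) = r.
  by rewrite ab4; congr Num.sqrt; field; rewrite gt_eqF.
(* Pulling 1/cos t out of the root produces its absolute value; cos t / |cos t| is the source of the
   sign in [k]. *)
have sqrt_v : 2 * cos t * Num.sqrt (16 / ((2 * cos t) ^+ 2 + 0 ^+ 2) - 1) = 2 * k.
  have -> : 16 / ((2 * cos t) ^+ 2 + 0 ^+ 2) - 1
      = (cos t)^-1 ^+ 2 * (4 - cos t ^+ 2) by field.
  rewrite sqrtrM ?sqr_ge0 // sqrtr_sqr normfV /k.
  have -> : Num.sg (cos t) = cos t / `|cos t|.
    by rewrite {2}[cos t]numEsg mulfK // normr_eq0.
  by ring.
have radu : M6_rad (x * (- 2 +i* (2 * sin t)))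
    = 'i%C * (x * (- 2 +i* (2 * sin t))) * (r%:C / 4).
  rewrite M6_rad_expi sqrrN ?sqrt_uw //.
  by rewrite rmorphM fmorphV rmorph_nat.
have radw : M6_rad (x * (2 +i* (2 * sin t)))
    = 'i%C * (x * (2 +i* (2 * sin t))) * (r%:C / 4).
  rewrite M6_rad_expi ?sqrt_uw //.
  by rewrite rmorphM fmorphV rmorph_nat.
have radv : M6_rad (x * (2 * cos t +i* 0)) = 'i%C * x * (k%:C / 2).
  rewrite M6_rad_expi; last by rewrite expr0n addr0 expf_neq0 // mulf_neq0.
  have -> : k%:C = (2 * k)%:C / 2 by rewrite (rmorphM _ 2) rmorph_nat; field.
  by rewrite -sqrt_v complexr0 !rmorphM fmorphV !rmorph_nat -/x; field.
rewrite uE vE wE radu radw radv.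
have ci (a b : R) : a +i* b = a%:C + 'i%C * b%:C by exact: complexE.
(* From here on the identities are polynomial in opaque [x], [r], [k], up to i^2 = -1. *)
clearbody x r k.
rewrite !(ci (- 2), ci 2, ci (-1), ci 1, ci (cos t), ci (2 * cos t)).
congr M6_shape.
all: rewrite ?rmorphN ?rmorphM ?rmorphN ?rmorph_nat ?rmorph0 ?rmorph1.
all: by field: i2.
Qed.

(** Along [F] the sign of cos is frozen to [e], so the closed form of the entries becomes continuous
    at [t0]. Taking [e] as a parameter covers both sides of a zero of cos, where [Num.sg (cos t0)]
    would be 0. *)
Lemma M6_family_cvg (R : realType) (F : set_system R) (FF : Filter F)
    (t0 e : R) :
  F `=>` nbhs t0 -> (\forall t \near F, cos t != 0 /\ Num.sg (cos t) = e) ->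
  let x := expi t0 in
  let r := Num.sqrt ((3 - sin t0 ^+ 2) / (1 + sin t0 ^+ 2)) in
  let k := e * Num.sqrt (4 - cos t0 ^+ 2) in
  (M6_family (expi t) : 'M[(R[i])^o]_6) @[t --> F] -->
    (M6_shape x
      (x * (-1 +i* sin t0) * (1 +i* r) / 2)
      (x * (-1 +i* sin t0) * (1 -i* r) / 2)
      (- (x * (cos t0 +i* k) / 2))
      (- (x * (cos t0 -i* k) / 2))
      (x * (1 +i* sin t0) * (1 +i* r) / 2)
      (x * (1 +i* sin t0) * (1 -i* r) / 2) : 'M[(R[i])^o]_6).
Proof.
move=> Ft0 Fe x r k.
pose rf (t : R) := Num.sqrt ((3 - sin t ^+ 2) / (1 + sin t ^+ 2)).
pose kf (t : R) := e * Num.sqrt (4 - cos t ^+ 2).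
apply: (@cvg_trans _ ((M6_shape (expi t)
      (expi t * (-1 +i* sin t) * (1 +i* rf t) / 2)
      (expi t * (-1 +i* sin t) * (1 -i* rf t) / 2)
      (- (expi t * (cos t +i* kf t) / 2))
      (- (expi t * (cos t -i* kf t) / 2))
      (expi t * (1 +i* sin t) * (1 +i* rf t) / 2)
      (expi t * (1 +i* sin t) * (1 -i* rf t) / 2) : 'M[(R[i])^o]_6) @[t --> F])).
  apply: near_eq_cvg; apply: filterS Fe => t [C0 sgC].
  by rewrite M6_family_expi // sgC.
have cosF : cos t @[t --> F] --> cos t0.
  by apply: cvg_trans (@continuous_cos R t0); exact: cvg_app.
have sinF : sin t @[t --> F] --> sin t0.
  by apply: cvg_trans (@continuous_sin R t0); exact: cvg_app.
have S2 : 1 + sin t0 ^+ 2 != 0 by rewrite gt_eqF // ltr_pwDl // sqr_ge0.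
have sqF (f : R -> R) (a : R) : f @ F --> a -> f t ^+ 2 @[t --> F] --> a ^+ 2.
  by move=> fa; rewrite expr2; apply: cvgM.
have sqrtF (f : R -> R) (a : R) : f @ F --> a -> Num.sqrt (f t) @[t --> F] --> Num.sqrt a.
  by move=> fa; apply: continuous_cvg => //; exact: sqrt_continuous.
have rF : rf t @[t --> F] --> r.
  apply: sqrtF; apply: cvgM.
    by apply: cvgB; [exact: cvg_cst | exact: sqF].
  by apply: cvgV => //; apply: cvgD; [exact: cvg_cst | exact: sqF].
have kF : kf t @[t --> F] --> k.
  apply: cvgM; first exact: cvg_cst.
  by apply: sqrtF; apply: cvgB; [exact: cvg_cst | exact: sqF].
have cst (a : R) : cst a @ F --> a by exact: cvg_cst.
have oppF (f : R -> R) (a : R) : f @ F --> a -> - f t @[t --> F] --> - a.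
  exact: cvgN.
(* Limit rules specialised to complex-valued functions, from which the limits of the entries are
   assembled by application alone. *)
pose cvgC (f : R -> R[i]) (l : R[i]) :=
  (f t : (R[i])^o) @[t --> F] --> (l : (R[i])^o).
have cplx (f g : R -> R) a b : f @ F --> a -> g @ F --> b ->
    cvgC (fun t => f t +i* g t) (a +i* b).
  exact: cvg_complex.
have mulF f g a b : cvgC f a -> cvgC g b -> cvgC (fun t => f t * g t) (a * b).
  exact: cvgM.
have oppC f a : cvgC f a -> cvgC (fun t => - f t) (- a) by exact: cvgN.
have half : cvgC (fun=> 2^-1) 2^-1 by exact: cvg_cst.
have xF := cplx _ _ _ _ cosF sinF.
have entry f g a b : cvgC f a -> cvgC g b ->
    cvgC (fun t => expi t * f t * g t / 2) (x * a * b / 2).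
  by move=> fa gb; exact: mulF _ _ _ _ (mulF _ _ _ _ (mulF _ _ _ _ xF fa) gb) half.
have entry1 f a : cvgC f a -> cvgC (fun t => - (expi t * f t / 2)) (- (x * a / 2)).
  by move=> fa; exact: oppC _ _ (mulF _ _ _ _ (mulF _ _ _ _ xF fa) half).
have uF := cplx _ _ _ _ (cst (-1)) sinF.
have wF := cplx _ _ _ _ (cst 1) sinF.
have r1F := cplx _ _ _ _ (cst 1) rF.
have r2F := cplx _ _ _ _ (cst 1) (oppF _ _ rF).
have k1F := cplx _ _ _ _ cosF kF.
have k2F := cplx _ _ _ _ cosF (oppF _ _ kF).
exact: (cvg_M6_shape FF xF (entry _ _ _ _ uF r1F) (entry _ _ _ _ uF r2F)
  (entry1 _ _ k1F) (entry1 _ _ k2F) (entry _ _ _ _ wF r1F) (entry _ _ _ _ wF r2F)).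
Qed.

(** * Roots of unity and the special matrices *)

Lemma norm_expi (R : realType) (t : R) : `|expi t| = 1.
Proof. by rewrite normc_def /= cos2Dsin2 sqrtr1. Qed.

Lemma expi0 (R : realType) : expi (0 : R) = 1.
Proof. by rewrite /expi cos0 sin0. Qed.

Lemma expiD (R : realType) (s t : R) : expi (s + t) = expi s * expi t.
Proof.
rewrite /expi cosD sinD; apply/eqP; rewrite eq_complex /= eqxx /=.
by apply/eqP; ring.
Qed.

Lemma expiMn (R : realType) (t : R) (n : nat) : expi (t * n%:R) = expi t ^+ n.
Proof.
elim: n => [|n IH]; first by rewrite mulr0 expi0.
by rewrite exprS -IH -expiD -natr1 mulrDr mulr1 addrC.
Qed.

(* With c = cos(pi/3), cos pi = 4c^3 - 3c gives (c + 1)(2c - 1)^2 = 0. *)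
Lemma cos_pi_3 (R : realType) : cos (pi / 3 : R) = 2^-1.
Proof.
have pi0 := pi_gt0 R.
have c0 : 0 < cos (pi / 3 : R) by apply: cos_gt0_pihalf; apply/andP; split; lra.
have c3 : cos (pi / 3 + (pi / 3 + pi / 3) : R) = -1.
  by rewrite (_ : _ + _ = pi) ?cospi //; field.
have := cos2Dsin2 (pi / 3 : R).
move: c3; rewrite !cosD sinD; move: c0.
move: (cos _) (sin _) => c s c0 c3 cs.
have /eqP : (c + 1) * (2 * c - 1) ^+ 2 = 0.
  have ss : s ^+ 2 = 1 - c ^+ 2 by rewrite -cs; ring.
  have c3' : 4 * c ^+ 3 - 3 * c = -1 by rewrite -c3; ring: ss.
  by rewrite (_ : (c + 1) * _ = 4 * c ^+ 3 - 3 * c + 1); [rewrite c3' addNr | ring].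
rewrite mulf_eq0 gt_eqF ?addr_gt0 //= sqrf_eq0 subr_eq0 => /eqP; lra.
Qed.

Lemma expi_pi_3 (R : realType) : expi (pi / 3 : R) = 2^-1 +i* (Num.sqrt 3 / 2).
Proof.
have pi0 := pi_gt0 R.
have s0 : 0 <= sin (pi / 3 : R) by apply: sin_ge0_pi; apply/andP; split; lra.
rewrite /expi cos_pi_3; congr (_ +i* _).
apply: (@pexpIrn R 2) => //; rewrite ?nnegrE ?divr_ge0 ?sqrtr_ge0 //.
by rewrite expr_div_n sqr_sqrtr // sin2cos2 cos_pi_3; field.
Qed.

Lemma expi_pi_3_sqr (R : realType) :
  expi (pi / 3 : R) ^+ 2 = expi (pi / 3 : R) - 1.
Proof.
rewrite expi_pi_3; apply/eqP; rewrite eq_complex /=; set s := Num.sqrt 3.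
have s2 : s ^+ 2 = 3 by rewrite sqr_sqrtr.
by apply/andP; split; apply/eqP; field: s2.
Qed.

Lemma F6_root_mx (R : realType) :
  F6 R = root_mx (expi (pi / 3 : R)) F6_exponents.
Proof.
apply/matrixP => i j; rewrite !mxE.
have -> : 2 * pi * i%:R * j%:R / 6 = pi / 3 * (i * j)%:R :> R.
  by rewrite natrM; field.
rewrite expiMn.
have z6 : expi (pi / 3 : R) ^+ 6 = 1 by ring: (expi_pi_3_sqr R).
rewrite -(expr_mod _ z6); congr (_ ^+ _).
by case: i => [[|[|[|[|[|[|i]]]]]] //= _]; case: j => [[|[|[|[|[|[|j]]]]]] //= _].
Qed.

Lemma D6_root_mx (R : realType) : D6 R = root_mx 'i%C D6_exponents.
Proof.
have i2 : 'i%C ^+ 2 = -1 :> R[i] by exact: sqr_i.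
have i3 : 'i%C ^+ 3 = - 'i%C :> R[i] by ring: i2.
apply/matrixP => i j; rewrite !mxE -?complexiE.
case: i => [[|[|[|[|[|[|i]]]]]] //= _]; case: j => [[|[|[|[|[|[|j]]]]]] //= _].
all: by rewrite /exponent /= ?expr0 ?expr1 ?i2 ?i3.
Qed.

(** Exponent table of [M6_shape] for a base whose power [h] is -1, so that a change of sign adds
    [h]: 3 for sixth roots, 2 for i. *)
Definition M6_exponents (h x d a b c p q : nat) : seq (seq nat) :=
  [:: [:: 0;      0; 0; 0;      0;      0];
      [:: 0;      h; x; x; x + h; x + h];
      [:: 0;      x; d; a;      b;      c];
      [:: 0;      x; a; d;      c;      b];
      [:: 0; x + h; b; c;      p;      q];
      [:: 0; x + h; c; b;      q;      p]]%N.

Lemma M6_shape_root_mx (R : realType) (z : R[i]) (h x d a b c p q : nat) :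
  z ^+ h = -1 ->
  M6_shape (z ^+ x) (z ^+ d) (z ^+ a) (z ^+ b) (z ^+ c) (z ^+ p) (z ^+ q) =
  root_mx z (M6_exponents h x d a b c p q).
Proof.
move=> zh; apply/matrixP => i j; rewrite !mxE.
case: i => [[|[|[|[|[|[|i]]]]]] //= _]; case: j => [[|[|[|[|[|[|j]]]]]] //= _].
all: by rewrite /exponent //= ?exprD ?zh ?mulrN1.
Qed.

Lemma M6_family_1 (R : realType) : hadamard_equiv (M6_family (1 : R[i])) (F6 R).
Proof.
have z1 := norm_expi (pi / 3 : R); have z2 := expi_pi_3_sqr R.
rewrite -(expi0 R) M6_family_expi cos0 ?oner_neq0 // sin0 F6_root_mx expi0.
set z := expi (pi / 3) in z1 z2 *.
have z3 : z ^+ 3 = -1 by ring: z2.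
have z6 : z ^+ 6 = 1 by ring: z2.
have s3 : Num.sqrt ((3 - 0 ^+ 2) / (1 + 0 ^+ 2)) = Num.sqrt 3 :> R.
  by congr Num.sqrt; field.
have k3 : Num.sg 1 * Num.sqrt (4 - 1 ^+ 2) = Num.sqrt 3 :> R.
  by rewrite sgr1 mul1r; congr Num.sqrt; ring.
have zE : z = (1 +i* Num.sqrt 3) / 2.
  rewrite /z expi_pi_3; apply/eqP; rewrite eq_complex /=.
  by apply/andP; split; apply/eqP; field.
have zE' : 1 - z = (1 -i* Num.sqrt 3) / 2.
  rewrite zE; apply/eqP; rewrite eq_complex /=.
  by apply/andP; split; apply/eqP; field.
rewrite s3 k3.
set M := M6_shape _ _ _ _ _ _ _.
(* Here d = b = -z = z^4, a = c = z - 1 = z^2, p = z and q = 1 - z = z^5. *)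
have -> : M = root_mx z (M6_exponents 3 0 4 2 4 2 1 5).
  rewrite /M -M6_shape_root_mx //.
  have -> : -1 +i* 0 = -1 :> R[i] by apply/eqP; rewrite eq_complex /= oppr0 !eqxx.
  have -> : 1 +i* 0 = 1 :> R[i] by [].
  have -> : 1 +i* Num.sqrt 3 = 2 * z by rewrite zE; field.
  have -> : 1 -i* Num.sqrt 3 = 2 * (1 - z) by rewrite zE'; field.
  by congr M6_shape; field: z2.
(* Row 1 has entries 1 and -1, so it is row 3 of F_6; rows 2 and 3 consist of cube roots of unity
   and are rows 2 and 4; the last two are rows 5 and 1. The columns follow the same relabelling,
   with all phases 1. *)
apply: (@root_mx_equiv _ _ 6 _ _ [:: 0; 3; 2; 4; 5; 1]
  [:: 0; 3; 2; 4; 5; 1] [::] [::])%N => //; last exact: F6_exponents_hadamard.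
move=> i j.
by case: i => [[|[|[|[|[|[|i]]]]]] //= _]; case: j => [[|[|[|[|[|[|j]]]]]] //= _].
Qed.

Lemma sqrtr_unique (R : rcfType) (x y : R) : 0 <= y -> y ^+ 2 = x -> Num.sqrt x = y.
Proof. by move=> y0 <-; rewrite sqrtr_sqr ger0_norm. Qed.

Lemma M6_family_fixed (R : realType) :
  M6_family (expi (acos ((1 - Num.sqrt 13) / 3))) = M6_fixed R.
Proof.
rewrite /M6_fixed; set s : R := Num.sqrt 13.
have s2 : s ^+ 2 = 13 by rewrite sqr_sqrtr.
have s0 : 0 <= s by exact: sqrtr_ge0.
have s3 : 3 < s by rewrite ltNge; apply/negP => ?; nra.
have s4 : s < 4 by rewrite ltNge; apply/negP => ?; nra.
(* With C = (1 - s)/3 one gets 9(1 - C^2) = 2s - 5 and 9(4 - C^2) = 22 + 2s. *)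
pose T := Num.sqrt (2 * s - 5); pose Q := Num.sqrt (22 + 2 * s).
have T0 : 0 <= T by exact: sqrtr_ge0.
have Q0 : 0 <= Q by exact: sqrtr_ge0.
have T2 : T ^+ 2 = 2 * s - 5 by rewrite sqr_sqrtr //; lra.
have Q2 : Q ^+ 2 = 22 + 2 * s by rewrite sqr_sqrtr //; lra.
have TQ : T <= Q by rewrite ler_sqrt; lra.
pose t := acos ((1 - s) / 3).
have cosE : cos t = (1 - s) / 3 by rewrite acosK // in_itv /=; apply/andP; split; lra.
have sinE : sin t = T / 3.
  rewrite sin_acos; last by apply/andP; split; lra.
  by apply: sqrtr_unique; [rewrite divr_ge0 | field: T2 s2].
(* The quotient is (16 - s)/(2 + s), which equals 2s - 5 because s^2 = 13. *)
have rE : Num.sqrt ((3 - sin t ^+ 2) / (1 + sin t ^+ 2)) = T.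
  apply: sqrtr_unique => //; rewrite sinE expr_div_n !T2.
  field: s2.
  by rewrite gt_eqF //; lra.
have kE : Num.sg (cos t) * Num.sqrt (4 - cos t ^+ 2) = - (Q / 3).
  rewrite ltr0_sg; last by rewrite cosE; lra.
  rewrite mulN1r; congr (- _); apply: sqrtr_unique; first by rewrite divr_ge0.
  by rewrite cosE; field: Q2 s2.
have -> : - 5 + 2 * s = 2 * s - 5 by ring.
rewrite -/T.
(* Each radicand is the square of a nonnegative polynomial in [s], [T], [Q]. The root of -2446 +
   730s comes before the two radicands containing it; [TQ] gives the sign of [Q - T]. *)
have -> : Num.sqrt (19 + 14 * s) = T * (2 + s).
  by apply: sqrtr_unique; [rewrite mulr_ge0 //; lra | ring: T2 s2].
have -> : Num.sqrt (- 58 + 34 * s) = T * Q.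
  by apply: sqrtr_unique; [rewrite mulr_ge0 | ring: T2 Q2 s2].
have -> : Num.sqrt (- 2446 + 730 * s) = (7 - s) * T * Q / 2.
  by apply: sqrtr_unique; [rewrite divr_ge0 ?mulr_ge0 //; lra | field: T2 Q2 s2].
have -> : Num.sqrt (134 + 22 * s - 8 * ((7 - s) * T * Q / 2)) = (s - 1) * (Q - T).
  by apply: sqrtr_unique; [rewrite mulr_ge0 //; lra | field: T2 Q2 s2].
have -> : Num.sqrt (134 + 22 * s + 8 * ((7 - s) * T * Q / 2)) = (s - 1) * (Q + T).
  by apply: sqrtr_unique; [rewrite mulr_ge0 //; lra | field: T2 Q2 s2].
have -> : Num.sqrt (- 21 + 6 * s) = T * (s - 2) / 3.
  by apply: sqrtr_unique; [rewrite divr_ge0 ?mulr_ge0 //; lra | field: T2 s2].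
have -> : Num.sqrt (- 122 + 38 * s) = T * (s - 1).
  by apply: sqrtr_unique; [rewrite mulr_ge0 //; lra | ring: T2 s2].
rewrite -/t M6_family_expi; last by rewrite lt_eqF // cosE; lra.
rewrite rE kE /expi cosE sinE; clearbody T Q s.
congr M6_shape; apply/eqP; rewrite eq_complex /=; apply/andP; split; apply/eqP.
all: by field: T2 Q2 s2.
Qed.

(** * One-sided limits at 3pi/2 *)

Lemma cos_3pi2 (R : realType) : cos (3 * pi / 2 : R) = 0.
Proof.
rewrite (_ : 3 * pi / 2 = pi / 2 + pi :> R); last by field.
by rewrite cosDpi cos_pihalf oppr0.
Qed.

Lemma sin_3pi2 (R : realType) : sin (3 * pi / 2 : R) = -1.
Proof.
rewrite (_ : 3 * pi / 2 = pi / 2 + pi :> R); last by field.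
by rewrite sinDpi sin_pihalf.
Qed.

Lemma cos_lt0_left_3pi2 (R : realType) :
  \forall t \near (3 * pi / 2 : R)^'-, cos t < 0.
Proof.
have pi0 := pi_gt0 R; near=> t.
have t1 : pi / 2 < t by near: t; apply: nbhs_left_gt; lra.
have t2 : t < 3 * pi / 2 by near: t; exact: nbhs_left_lt.
rewrite -(subrK pi t) cosDpi oppr_lt0; apply: cos_gt0_pihalf.
by apply/andP; split; lra.
Unshelve. all: by end_near. Qed.

Lemma cos_gt0_right_3pi2 (R : realType) :
  \forall t \near (3 * pi / 2 : R)^'+, 0 < cos t.
Proof.
have pi0 := pi_gt0 R; near=> t.
have t1 : 3 * pi / 2 < t by near: t; exact: nbhs_right_gt.
(* 5pi/2 is the next zero of cos. *)
have t2 : t < 5 * pi / 2 by near: t; apply: nbhs_right_lt; lra.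
rewrite -(subrK (pi *+ 2) t) cosD2pi; apply: cos_gt0_pihalf.
by rewrite -mulr_natl; apply/andP; split; lra.
Unshelve. all: by end_near. Qed.

(** At 3pi/2 one has x = -i, S = -1, r = 1 and k = 2e, which makes all limit entries powers of i.
    The side enters only through b = -e and c = e. *)
Lemma M6_family_cvg_3pi2 (R : realType) (F : set_system R) (FF : Filter F)
    (e : R) (b c : nat) :
  F `=>` nbhs (3 * pi / 2 : R) ->
  (\forall t \near F, cos t != 0 /\ Num.sg (cos t) = e) ->
  'i%C ^+ b = - e%:C -> 'i%C ^+ c = e%:C ->
  (M6_family (expi t) : 'M[(R[i])^o]_6) @[t --> F] -->
    (root_mx 'i%C (M6_exponents 2 3 2 1 b c 3 2) : 'M[(R[i])^o]_6).
Proof.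
move=> Ft Fe ib ic.
have i2 : 'i%C ^+ 2 = -1 :> R[i] by exact: sqr_i.
have r1 : Num.sqrt ((3 - (- 1) ^+ 2) / (1 + (- 1) ^+ 2)) = 1 :> R.
  by apply: sqrtr_unique => //; field.
have k2 : Num.sqrt (4 - 0 ^+ 2) = 2 :> R by apply: sqrtr_unique => //; ring.
have := M6_family_cvg FF Ft Fe; rewrite /= /expi cos_3pi2 sin_3pi2 r1 k2.
set M := M6_shape _ _ _ _ _ _ _.
suff -> : M = root_mx 'i%C (M6_exponents 2 3 2 1 b c 3 2) by apply.
rewrite -(M6_shape_root_mx 3 2 1 b c 3 2 i2) ib ic.
have ci (a a' : R) : a +i* a' = a%:C + 'i%C * a'%:C by exact: complexE.
rewrite /M !(ci 0 (-1), ci (-1), ci 1, ci 0 (e * 2), ci 0 (- (e * 2))).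
congr M6_shape.
all: rewrite ?rmorphN ?rmorphM ?rmorph_nat ?rmorph0 ?rmorph1.
all: by field: i2.
Qed.

Lemma M6_limit_equiv_D6 (R : realType) :
  hadamard_equiv (root_mx ('i%C : R[i]) (M6_exponents 2 3 2 1 0 2 3 2)) (D6 R) /\
  hadamard_equiv (root_mx ('i%C : R[i]) (M6_exponents 2 3 2 1 2 0 3 2)) (D6 R).
Proof.
have i2 : 'i%C ^+ 2 = -1 :> R[i] by exact: sqr_i.
have i4 : 'i%C ^+ 4 = 1 :> R[i] by ring: i2.
have i1 : `|'i%C : R[i]| = 1 by rewrite complexiE normCi.
rewrite D6_root_mx; split.
(* The permutations and row phases were found by a finite search. *)
- apply: (@root_mx_equiv _ _ 4 _ _ [:: 0; 1; 2; 5; 3; 4]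
    [:: 1; 0; 5; 2; 3; 4] [:: 0; 2; 3; 3; 1; 1] [::])%N => //;
    last exact: D6_exponents_hadamard.
  move=> i j.
  by case: i => [[|[|[|[|[|[|i]]]]]] //= _]; case: j => [[|[|[|[|[|[|j]]]]]] //= _].
(* Exchanging the last two rows and the last two columns swaps b and c, so the lists of the first
   case serve with their last two permutation entries exchanged. *)
- apply: (@root_mx_equiv _ _ 4 _ _ [:: 0; 1; 2; 5; 4; 3]
    [:: 1; 0; 5; 2; 4; 3] [:: 0; 2; 3; 3; 1; 1] [::])%N => //;
    last exact: D6_exponents_hadamard.
  move=> i j.
  by case: i => [[|[|[|[|[|[|i]]]]]] //= _]; case: j => [[|[|[|[|[|[|j]]]]]] //= _].
Qed.

(** The limit in (2) is taken from each side separately, as b and c tend to opposite values; both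
    limits are equivalent to D_6. *)
Theorem mainTheorem3 (R : realType) :
  [/\ hadamard_equiv (M6_family (1 : R[i])) (F6 R),
      exists Lm Lp : 'M[R[i]]_6,
        [/\ (M6_family (expi t) : 'M[(R[i])^o]_6)
              @[t --> (3 * pi / 2 : R)^'-] --> (Lm : 'M[(R[i])^o]_6),
            (M6_family (expi t) : 'M[(R[i])^o]_6)
              @[t --> (3 * pi / 2 : R)^'+] --> (Lp : 'M[(R[i])^o]_6),
            hadamard_equiv Lm (D6 R) &
            hadamard_equiv Lp (D6 R)] &
      M6_family (expi (acos ((1 - Num.sqrt 13) / 3))) = M6_fixed R].
Proof.
split; [exact: M6_family_1 | | exact: M6_family_fixed].
have [Lm_D6 Lp_D6] := M6_limit_equiv_D6 R.
exists (root_mx 'i%C (M6_exponents 2 3 2 1 0 2 3 2)).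
exists (root_mx 'i%C (M6_exponents 2 3 2 1 2 0 3 2)).
split; [| | exact: Lm_D6 | exact: Lp_D6].
(* On the left cos is negative, giving b = 1 and c = -1; on the right the two are exchanged. *)
- apply: (@M6_family_cvg_3pi2 R _ _ (-1)).
  + exact: cvg_within.
  + apply: filterS (cos_lt0_left_3pi2 R) => t ct0.
    by rewrite lt_eqF // ltr0_sg.
  + by rewrite rmorphN opprK.
  + by rewrite rmorphN; exact: sqr_i.
- apply: (@M6_family_cvg_3pi2 R _ _ 1).
  + exact: cvg_within.
  + apply: filterS (cos_gt0_right_3pi2 R) => t ct0.
    by rewrite gt_eqF // gtr0_sg.
  + exact: sqr_i.
  + by [].
Qed.
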